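(* Let $\mathcal{M}$ be a countably infinite structure over a finite relational vocabulary which is model-complete and $\omega$-categorical. Then $Age(\mathcal{M})$ satisfies SEAP if and only if $\mathcal{M}$ is homogenizable.
   Context: All vocabularies are finite relational; formulas are first order. $Age(\mathcal{M})$ is the class of finite substructures of $\mathcal{M}$ (up to isomorphism). A structure $\mathcal{M}$ is homogeneous if every isomorphism between finite substructures of $\mathcal{M}$ (equivalently every embedding $f:\mathcal{A}\to\mathcal{M}$ of a finite substructure $\mathcal{A}\subseteq\mathcal{M}$) extends to an automorphism of $\mathcal{M}$. A $V$-structure $\mathcal{M}$ is homogenizable if there are finitely many formulas $\varphi_1(\bar x_1),\dots,\varphi_n(\bar x_n)$ (without parameters) such that, adding new relation symbols $R_i$ of the arity of $\varphi_i$ and letting $V'=V\cup\{R_1,\dots,R_n\}$, the $V'$-expansion $\mathcal{N}$ of $\mathcal{M}$ with $\mathcal{N}\models R_i(\bar a)\leftrightarrow\varphi_i(\bar a)$ for all $\bar a$ is homogeneous. Given a class $\mathbf{K}$ of finite structures and embeddings $f:\mathcal{A}\to\mathcal{B}$, $g:\mathcal{A}\to\mathcal{C}$ with $\mathcal{A},\mathcal{B},\mathcal{C}\in\mathbf{K}$, an amalgam for $f,g$ is a $\mathcal{D}\in\mathbf{K}$ with embeddings $f_0:\mathcal{B}\to\mathcal{D}$, $g_0:\mathcal{C}\to\mathcal{D}$ such that $f_0(f(x))=g_0(g(x))$ for all $x\in A$. For $k,m\in\mathbb{N}$, $\mathbf{K}$ satisfies SEAP$_{k,m}$ if: whenever $\mathcal{A},\mathcal{B},\mathcal{C}\in\mathbf{K}$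 and embeddings $f:\mathcal{A}\to\mathcal{B}$, $g:\mathcal{A}\to\mathcal{C}$ have no amalgam, there exist $\mathcal{A}_0\subseteq\mathcal{A}$, $\mathcal{B}_0\supseteq\mathcal{B}$, $\mathcal{C}_0\supseteq\mathcal{C}$ (with $\mathcal{B}_0,\mathcal{C}_0\in\mathbf{K}$) with $|A_0|<k$, $|B_0|-|B|<m$, $|C_0|-|C|<m$ such that $f\upharpoonright A_0:\mathcal{A}_0\to\mathcal{B}_0$ and $g\upharpoonright A_0:\mathcal{A}_0\to\mathcal{C}_0$ have no amalgam. $\mathbf{K}$ satisfies SEAP if it satisfies SEAP$_{k,m}$ for some $k,m\in\mathbb{N}$. *)

(* Defs.v *)
From HB Require Import structures.
From mathcomp Require Import all_boot.
From mathcomp Require Import boolp classical_sets functions cardinality.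

Set Implicit Arguments.
Unset Strict Implicit.
Unset Printing Implicit Defensive.

Local Open Scope classical_set_scope.

Record vocabulary := Vocabulary {
  rel_sym : finType;
  arity : rel_sym -> nat
}.

Record structure (V : vocabulary) := Structure {
  carrier :> Type;
  interp : forall R : rel_sym V, (arity R).-tuple carrier -> Prop
}.

Record fin_structure (V : vocabulary) := FinStructure {
  fin_carrier : finType;
  fin_interp : forall R : rel_sym V, (arity R).-tuple fin_carrier -> Prop
}.

Coercion structure_of_fin (V : vocabulary) (A : fin_structure V)
  : structure V := Structure (@fin_interp V A).

Definition card_fin (V : vocabulary) (A : fin_structure V) : nat :=
  #|fin_carrier A|.

(* [formula V n]: first-card_fin formulas with free variables among x_0, ...,
   x_(n-1).  Under [FAll] the bound variable is x_0 and the others are shifted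
   by one.  The missing connectives and the existential quantifier are
   classically definable. *)
Inductive formula (V : vocabulary) : nat -> Type :=
| FBot n : formula V n
| FEq n (i j : 'I_n) : formula V n
| FRel n (R : rel_sym V) (t : (arity R).-tuple 'I_n) : formula V n
| FImp n (phi psi : formula V n) : formula V n
| FAll n (phi : formula V n.+1) : formula V n.

Fixpoint sat (V : vocabulary) (M : structure V) n (phi : formula V n)
    : n.-tuple M -> Prop :=
  match phi in formula _ n return n.-tuple M -> Prop with
  | FBot _ => fun _ => False
  | FEq _ i j => fun v => tnth v i = tnth v j
  | FRel _ R t => fun v => interp (map_tuple (tnth v) t)
  | FImp _ phi psi => fun v => sat phi v -> sat psi v
  | FAll _ phi => fun v => forall a : M, sat phi (cons_tuple a v)
  end.

Section Maps.
Variables (V : vocabulary) (A B : structure V) (f : A -> B).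

Definition embedding : Prop :=
  injective f /\
  forall (R : rel_sym V) (t : (arity R).-tuple A),
    interp t <-> interp (map_tuple f t).

Definition isomorphism : Prop := embedding /\ bijective f.

Definition elementary : Prop :=
  forall n (phi : formula V n) (v : n.-tuple A),
    sat phi v <-> sat phi (map_tuple f v).

End Maps.

Definition substructure (V : vocabulary) (M : structure V) (S : set M)
    : structure V :=
  @Structure V {x : M | S x}
    (fun R t => interp (map_tuple (@proj1_sig M S) t)).

Definition theory (V : vocabulary) : Type := set (formula V 0).

Definition Th (V : vocabulary) (M : structure V) : theory V :=
  [set phi | sat (M := M) phi [tuple]].

Definition models (V : vocabulary) (M : structure V) (T : theory V) : Prop :=
  T `<=` Th M.

Definition countably_infinite (T : Type) : Prop := ([set: T] #= [set: nat])%card.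

Definition model_complete_theory (V : vocabulary) (T : theory V) : Prop :=
  forall (N1 N2 : structure V) (f : N1 -> N2),
    models N1 T -> models N2 T -> embedding f -> elementary f.

Definition omega_categorical_theory (V : vocabulary) (T : theory V) : Prop :=
  exists N : structure V,
    [/\ countably_infinite N, models N T &
      forall N' : structure V, countably_infinite N' -> models N' T ->
        exists f : N' -> N, isomorphism f].

Definition model_complete (V : vocabulary) (M : structure V) : Prop :=
  model_complete_theory (Th M).

Definition omega_categorical (V : vocabulary) (M : structure V) : Prop :=
  omega_categorical_theory (Th M).

Definition homogeneous (V : vocabulary) (M : structure V) : Prop :=
  forall S T : set M, finite_set S -> finite_set T ->
  forall h : substructure S -> substructure T, isomorphism h ->
  exists2 s : M -> M, isomorphism s &
    forall x : substructure S, s (proj1_sig x) = proj1_sig (h x).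

Section Homogenizable.
Variables (V : vocabulary) (p : nat) (ar : 'I_p -> nat).

Definition expanded_vocabulary : vocabulary :=
  @Vocabulary (rel_sym V + 'I_p)%type
    (fun s => match s with inl R => arity R | inr i => ar i end).

Definition definable_expansion (M : structure V)
    (phi : forall i : 'I_p, formula V (ar i)) : structure expanded_vocabulary :=
  @Structure expanded_vocabulary M
    (fun s => match s return (@arity expanded_vocabulary s).-tuple M -> Prop with
              | inl R => @interp V M R
              | inr i => @sat V M (ar i) (phi i)
              end).

End Homogenizable.

Definition homogenizable (V : vocabulary) (M : structure V) : Prop :=
  exists (p : nat) (ar : 'I_p -> nat) (phi : forall i : 'I_p, formula V (ar i)),
    homogeneous (definable_expansion M phi).

Definition Age (V : vocabulary) (M : structure V) : fin_structure V -> Prop :=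
  fun A => exists f : A -> M, embedding f.

Definition has_amalgam (V : vocabulary) (K : fin_structure V -> Prop)
    (A B C : structure V) (f : A -> B) (g : A -> C) : Prop :=
  exists (D : fin_structure V) (f0 : B -> D) (g0 : C -> D),
    [/\ K D, embedding f0, embedding g0 & forall x, f0 (f x) = g0 (g x)].

(* The extensions B0 of B and C0 of C are given with their inclusion maps iB
   and iC; the truncated subtractions are exact because these are injective. *)
Definition SEAP_km (V : vocabulary) (K : fin_structure V -> Prop) (k m : nat)
    : Prop :=
  forall (A B C : fin_structure V) (f : A -> B) (g : A -> C),
    K A -> K B -> K C -> embedding f -> embedding g ->
    ~ has_amalgam K f g ->
  exists (A0 : {set fin_carrier A}) (B0 C0 : fin_structure V)
         (iB : B -> B0) (iC : C -> C0),
    [/\ K B0 /\ K C0,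
        embedding iB /\ embedding iC,
        #|A0| < k,
        card_fin B0 - card_fin B < m /\ card_fin C0 - card_fin C < m &
        ~ has_amalgam K (A := @substructure V A [set` A0])
            (fun x => iB (f (proj1_sig x))) (fun x => iC (g (proj1_sig x)))].

Definition SEAP (V : vocabulary) (K : fin_structure V -> Prop) : Prop :=
  exists k m : nat, SEAP_km K k m.

(* Main.v *)
(* By omega-categoricity, countable structures elementarily equivalent to [M] are
   isomorphic to [M].  Applied to countable elementary substructures of an
   ultrapower, this realizes in [M] every countable type finitely satisfiable in
   [M]; applied to an atomic elementary substructure of [M], it shows that every
   type realized in [M] is isolated.  Hence there are finitely many [n]-types, and
   tuples of the same type are conjugate under automorphisms.  By model
   completeness, the type of a tuple [v] is already determined by some finite set
   [s] containing [v]: every embedding of [s] into [M] preserves the type of [v].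

   Suppose SEAP_{k,m} holds, and expand [M] by all types of fewer than [k] elements.
   If [v] and [w] have the same relations in the expansion but different types, the
   finite sets determining these types have no amalgam over [v ~ w]; SEAP then gives
   fewer than [k] elements with the same property, although these have the same
   type.  Conversely, let [M] be homogenized by formulas [phi_i].  If [B] and [C] in
   [M] have no amalgam over [A], the two copies of [A] disagree on some [phi_i] at
   some tuple, and adding finite sets of bounded size that determine the types of
   the two images of this tuple removes every amalgam over the tuple. *)

Require Import Defs.
From mathcomp Require Import all_boot.
From mathcomp Require Import boolp classical_sets functions cardinality filter.

Set Implicit Arguments.
Unset Strict Implicit.
Unset Printing Implicit Defensive.

Local Open Scope classical_set_scope.

(** * Formulas and types *)

Section Formulas.
Variable V : vocabulary.
Implicit Types M N P : structure V.

Definition FNot n (phi : formula V n) := FImp phi (FBot V n).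
Definition FTop n : formula V n := FNot (FBot V n).
Definition FAnd n (phi psi : formula V n) := FNot (FImp phi (FNot psi)).
Definition FEx n (phi : formula V n.+1) := FNot (FAll (FNot phi)).
Definition FConj n (I : Type) (s : seq I) (F : I -> formula V n) :=
  foldr (fun i psi => FAnd (F i) psi) (FTop n) s.

Lemma sat_and M n (phi psi : formula V n) (v : n.-tuple M) :
  sat (FAnd phi psi) v <-> sat phi v /\ sat psi v.
Proof.
split=> [h|[h1 h2] h]; last exact: h h1 h2.
by split; apply: contrapT => n1; apply: h => ? // ?.
Qed.

Lemma sat_ex M n (phi : formula V n.+1) (v : n.-tuple M) :
  sat (FEx phi) v <-> exists a, sat phi (cons_tuple a v).
Proof.
split=> [h|[a ha] h]; last exact: h a ha.
by apply: contrapT => /forallNP hn; apply: h => a; apply: hn.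
Qed.

Lemma sat_conj M n (I : eqType) (s : seq I) (F : I -> formula V n)
    (v : n.-tuple M) :
  sat (FConj s F) v <-> forall i, i \in s -> sat (F i) v.
Proof.
elim: s => [|i s IH]; first by split=> // _ [].
rewrite [FConj _ _]/= sat_and IH; split=> [[h1 h2] j|h].
  by rewrite in_cons => /predU1P[->|/h2].
by split=> [|j js]; apply: h; rewrite in_cons ?eqxx // js orbT.
Qed.

Fixpoint FExs k n : formula V (k + n) -> formula V n :=
  match k with
  | 0 => id
  | k'.+1 => fun phi => FExs (@FEx (k' + n) phi)
  end.

Lemma sat_exs M k n (phi : formula V (k + n)) (v : n.-tuple M) :
  sat (FExs phi) v <-> exists y : k.-tuple M, sat phi (cat_tuple y v).
Proof.
elim: k phi => [|k IH] phi /=.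
  split=> [h|[y]].
    by exists [tuple]; rewrite (_ : cat_tuple _ _ = v :> (0 + n).-tuple M) //; exact: val_inj.
  by rewrite (tuple0 y) (_ : cat_tuple _ _ = v :> (0 + n).-tuple M) //; exact: val_inj.
rewrite IH; split=> [[y /sat_ex[a ha]]|[y hy]].
  exists (cons_tuple a y).
  by congr (sat phi _): ha; apply: val_inj.
exists (behead_tuple y); apply/sat_ex; exists (thead y).
by congr (sat phi _): hy; apply: val_inj; rewrite /= {1}(tuple_eta y).
Qed.

Fixpoint rename n (phi : formula V n) : forall m, n.-tuple 'I_m -> formula V m :=
  match phi in formula _ n return forall m, n.-tuple 'I_m -> formula V m with
  | FBot _ => fun m _ => FBot V m
  | FEq _ i j => fun m t => FEq V (tnth t i) (tnth t j)
  | FRel _ R u => fun m t => FRel (map_tuple (tnth t) u)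
  | FImp _ phi psi => fun m t => FImp (rename phi t) (rename psi t)
  | FAll _ phi => fun m t =>
      FAll (rename phi (cons_tuple ord0 (map_tuple (lift ord0) t)))
  end.

Lemma map_tuple_comp (A B C : Type) n (f : B -> C) (g : A -> B) (t : n.-tuple A) :
  map_tuple f (map_tuple g t) = map_tuple (f \o g) t.
Proof. by apply: val_inj; rewrite /= -map_comp. Qed.

Lemma map_cons_tuple (A B : Type) n (f : A -> B) a (t : n.-tuple A) :
  map_tuple f (cons_tuple a t) = cons_tuple (f a) (map_tuple f t).
Proof. exact: val_inj. Qed.

Lemma eq_map_tuple (A B : Type) n (f g : A -> B) (t : n.-tuple A) :
  (forall i, f (tnth t i) = g (tnth t i)) -> map_tuple f t = map_tuple g t.
Proof. by move=> fg; apply: eq_from_tnth => i; rewrite !tnth_map. Qed.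

Lemma map_tuple_tnth (A B : Type) n m (f : A -> B) (v : m.-tuple A)
    (t : n.-tuple 'I_m) :
  map_tuple f (map_tuple (tnth v) t) = map_tuple (tnth (map_tuple f v)) t.
Proof. by rewrite map_tuple_comp; apply: eq_map_tuple => i; rewrite /= tnth_map. Qed.

Lemma map_tuple_id (A : Type) n (f : A -> A) (t : n.-tuple A) :
  (forall i, f (tnth t i) = tnth t i) -> map_tuple f t = t.
Proof. by move=> fg; apply: eq_from_tnth => i; rewrite !tnth_map. Qed.

Lemma sat_rename M n (phi : formula V n) m (t : n.-tuple 'I_m)
    (v : m.-tuple M) :
  sat (rename phi t) v <-> sat phi (map_tuple (tnth v) t).
Proof.
elim: phi m t v => {n} [n|n i j|n R u|n phi IH1 psi IH2|n phi IH] m t v //=.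
- by rewrite !tnth_map.
- by rewrite map_tuple_tnth.
- by rewrite IH1 IH2.
- have E a : map_tuple (tnth (cons_tuple a v))
      (cons_tuple ord0 (map_tuple (lift ord0) t)) =
      cons_tuple a (map_tuple (tnth v) t).
    rewrite map_cons_tuple tnth0 map_tuple_comp; congr cons_tuple.
    by apply: eq_map_tuple => i; rewrite /= tnthS.
  by split=> h a; have := h a; rewrite IH E.
Qed.

(** The entries of [w] may repeat or omit entries of [y], so [psi] quantifies over a whole tuple [y]
    and ties it to [w] by equations. This carries isolating formulas over to reindexed tuples. *)
Lemma FProj K n (phi : formula V K) (r : n.-tuple 'I_K) :
  exists psi : formula V n, forall M (w : n.-tuple M),
    sat psi w <-> exists y : K.-tuple M, sat phi y /\ w = map_tuple (tnth y) r.
Proof.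
exists (FExs (FAnd (rename phi [tuple lshift n i | i < K])
  (FConj (enum 'I_n) (fun i => FEq V (lshift n (tnth r i)) (rshift K i))))).
move=> M w; rewrite sat_exs.
have E (y : K.-tuple M) : map_tuple (tnth (cat_tuple y w)) [tuple lshift n i | i < K] = y.
  by apply: eq_from_tnth => i; rewrite tnth_map tnth_mktuple tnth_lshift.
split=> -[y].
  rewrite sat_and sat_rename E sat_conj => -[h1 h2]; exists y; split=> //.
  apply: eq_from_tnth => i.
  have := h2 i; rewrite mem_enum => /(_ isT) /=.
  by rewrite tnth_lshift tnth_rshift tnth_map => ->.
move=> [h1 h2]; exists y; rewrite sat_and sat_rename E sat_conj; split=> // i _ /=.
by rewrite tnth_lshift tnth_rshift h2 tnth_map.
Qed.

Definition eqtp M N n (v : n.-tuple M) (w : n.-tuple N) :=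
  forall phi : formula V n, sat phi v <-> sat phi w.

Lemma eqtp_sym M N n (v : n.-tuple M) (w : n.-tuple N) : eqtp v w -> eqtp w v.
Proof. by move=> h phi; rewrite h. Qed.

Lemma eqtp_trans M N P n (v : n.-tuple M) (w : n.-tuple N) (u : n.-tuple P) :
  eqtp v w -> eqtp w u -> eqtp v u.
Proof. by move=> h1 h2 phi; rewrite h1 h2. Qed.

Lemma eqtp_reindex M N n m (v : m.-tuple M) (w : m.-tuple N)
    (t : n.-tuple 'I_m) :
  eqtp v w -> eqtp (map_tuple (tnth v) t) (map_tuple (tnth w) t).
Proof. by move=> h phi; rewrite -!sat_rename. Qed.

Lemma iso_elementary M N (f : M -> N) : isomorphism f -> elementary f.
Proof.
case=> -[finj frel] [g fK gK] n phi.
elim: phi => {n} [n|n i j|n R u|n phi IH1 psi IH2|n phi IH] v //=.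
- by rewrite !tnth_map; split=> [->|/finj].
- by rewrite frel map_tuple_tnth.
- by rewrite IH1 IH2.
- split=> h a; last by rewrite IH map_cons_tuple.
  by rewrite -(gK a) -map_cons_tuple -IH.
Qed.

Lemma isomorphism_inv M N (f : M -> N) :
  isomorphism f -> exists g : N -> M, [/\ isomorphism g, cancel f g & cancel g f].
Proof.
move=> [[finj frel] [g fK gK]]; exists g; split=> //; split; last by exists f.
split; first exact: can_inj gK.
move=> R t; rewrite frel map_tuple_comp map_tuple_id //= => i; exact: gK.
Qed.

Lemma isomorphism_comp M N P (f : M -> N) (g : N -> P) :
  isomorphism f -> isomorphism g -> isomorphism (g \o f).
Proof.
move=> [[fi fr] fb] [[gi gr] gb]; split; last exact: bij_comp.
split; first exact: inj_comp.
by move=> R t; rewrite fr gr map_tuple_comp.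
Qed.

Lemma elementary_models M N (f : M -> N) : elementary f -> models N (Th M).
Proof.
move=> fe phi h; have E : [tuple] = map_tuple f [tuple] by exact: val_inj.
by rewrite /Th /= E -fe.
Qed.

Lemma elementary_models_inv M N (f : M -> N) : elementary f -> models M (Th N).
Proof.
move=> fe phi h; have E : [tuple] = map_tuple f [tuple] by exact: val_inj.
by rewrite /Th /= fe -E.
Qed.

Lemma elementary_embedding M N (f : M -> N) : elementary f -> embedding f.
Proof.
move=> fe; split=> [x y xy|R t].
  have := fe 2 (FEq V ord0 (lift ord0 ord0)) [tuple x; y].
  by rewrite /= !tnthS !tnth0 => h; apply/h.
have E A (u : (arity R).-tuple A) : map_tuple (tnth u) [tuple i | i < arity R] = u.
  by apply: eq_from_tnth => i; rewrite tnth_map tnth_mktuple.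
by have := fe _ (FRel [tuple i | i < arity R]) t; rewrite /= !E.
Qed.

Lemma countable_setU T (A B : set T) :
  countable A -> countable B -> countable (A `|` B).
Proof.
move=> cA cB; rewrite -bigcup2E; apply: bigcup_countable; first exact: countableP.
by case=> [|[|i]] _ //=; exact: countable0.
Qed.

(** Induction on a bound for the depth, for all [n] at once because [FAll] changes the number of
    free variables. *)
Lemma countable_formula n : countable [set: formula V n].
Proof.
pose F := fix F d n : set (formula V n) :=
  if d isn't d'.+1 then
    [set FBot V n] `|` [set FEq V ij.1 ij.2 | ij in [set: 'I_n * 'I_n]]
      `|` \bigcup_(R in [set: rel_sym V])
            [set FRel t | t in [set: (arity R).-tuple 'I_n]]
  else F d' n `|` [set FImp pq.1 pq.2 | pq in F d' n `*` F d' n]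
      `|` [set FAll p | p in F d' n.+1].
have cF d : forall n, countable (F d n).
  elim: d => [|d IH] {}n /=.
    apply: countable_setU; first apply: countable_setU.
    - exact: countable1.
    - by apply: card_le_trans (card_image_le _ _) _; apply: countableP.
    - apply: bigcup_countable; first exact: countableP.
      by move=> R _; apply: card_le_trans (card_image_le _ _) _; apply: countableP.
  apply: countable_setU; first apply: countable_setU => //.
    by apply: card_le_trans (card_image_le _ _) _; apply: countableX.
  by apply: card_le_trans (card_image_le _ _) _; apply: IH.
have Fmono d e m : d <= e -> F d m `<=` F e m.
  elim: e d m => [|e IH] d m; first by rewrite leqn0 => /eqP->.
  rewrite leq_eqVlt => /predU1P[-> //|]; rewrite ltnS => de x hx.
  by left; left; apply: IH hx.
apply: sub_countable (bigcup_countable (D := [set: nat]) (F := F^~ n) _ _) => //.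
apply: subset_card_le => phi _ /=.
elim: phi => {n} [n|n i j|n R u|n phi [d _ h1] psi [e _ h2]|n phi [d _ h]].
- by exists 0 => //; left; left.
- by exists 0 => //; left; right; exists (i, j).
- by exists 0 => //; right; exists R => //; exists u.
- exists (maxn d e).+1 => //; left; right; exists (phi, psi) => //=.
  by split; apply: Fmono; [exact: leq_maxl| |exact: leq_maxr|].
- by exists d.+1 => //; right; exists phi.
Qed.

End Formulas.

(** * Ultrapowers *)

Section Ultrapower.
Variables (V : vocabulary) (M : structure V) (U : set_system nat).
Context {UU : UltraFilter U}.

Let UF : Filter U := _.
Let UI A B : U A -> U B -> U (A `&` B). Proof. exact: filterI. Qed.
Let UE A : U A -> exists k, A k. Proof. exact: filter_ex. Qed.
Let US A B : A `<=` B -> U A -> U B. Proof. exact: filterS. Qed.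
Let UT A : (forall k, A k) -> U A.
Proof. by move=> h; apply: filterS filterT => k _; exact: h. Qed.

Lemma ultraC (A : set nat) : U (~` A) <-> ~ U A.
Proof.
split=> [hC h|h]; last by have [] := in_ultra_setVsetC A UU.
by have /UE[k []] := UI h hC.
Qed.

Definition ueq (f g : nat -> M) : Prop := U [set k | f k = g k].

Lemma ueq_trans f g h : ueq f g -> ueq g h -> ueq f h.
Proof. by move=> h1 h2; apply: US (UI h1 h2) => k /= [-> ->]. Qed.

Lemma ueq_sym f g : ueq f g -> ueq g f.
Proof. by move=> h; apply: US h => k /= ->. Qed.

Lemma ueq_refl f : ueq f f.
Proof. by apply: UT. Qed.

(** The quotient consists of the classes themselves, so that extensionality turns [ueq] into
    equality; representatives are recovered by choice. *)
Definition ultra_carrier := {C : set (nat -> M) | exists f, C = ueq f}.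

Definition uclass (f : nat -> M) : ultra_carrier :=
  exist _ (ueq f) (ex_intro _ f erefl).

Definition urep (c : ultra_carrier) : nat -> M := projT1 (cid (proj2_sig c)).

Lemma uclass_eq f g : ueq f g -> uclass f = uclass g.
Proof.
move=> h; apply: eq_exist; apply/funext => x; apply/propext.
by split; apply: ueq_trans => //; exact: ueq_sym.
Qed.

Lemma urepK c : uclass (urep c) = c.
Proof.
case: c => C hC; apply: eq_exist.
by rewrite /urep; case: cid => f /=.
Qed.

Lemma uclassK f : ueq (urep (uclass f)) f.
Proof.
have := urepK (uclass f) => /(congr1 (@proj1_sig _ _)) /= ->.
exact: ueq_refl.
Qed.

Definition ultrapower : structure V :=
  @Structure V ultra_carrier
    (fun R t => U [set k | interp (map_tuple (urep ^~ k) t)]).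

(** Los's theorem. In the universal case, if the formula fails on a set of indices in [U], a
    function choosing a counterexample at each such index represents a counterexample in the
    ultrapower. *)
Lemma los n (phi : formula V n) (t : n.-tuple ultrapower) :
  sat phi t <-> U [set k | sat phi (map_tuple (urep ^~ k) t)].
Proof.
elim: phi t => {n} [n|n i j|n R u|n phi IH1 psi IH2|n phi IH] t /=.
- by split=> // /UE[].
- split=> [E|h].
    by apply: UT => k /=; rewrite !tnth_map E.
  rewrite -(urepK (tnth t i)) -(urepK (tnth t j)); apply: uclass_eq.
  by apply: US h => k /=; rewrite !tnth_map.
- by split; apply: US => k /=; rewrite map_tuple_tnth.
- rewrite IH1 IH2; split=> [h|h h1]; last first.
    by apply: US (UI h h1) => k /= [h2 /h2].
  apply: contrapT => /ultraC hn.
  have h1 : U [set k | sat phi (map_tuple (urep ^~ k) t)].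
    by apply: US hn => k /=; apply: contra_notP => ?.
  have /UE[k [] /=] := UI hn (h h1).
  by move=> hk1 hk2; apply: hk1.
- split=> [h|h a]; last first.
    rewrite IH; apply: US h => k /= /(_ (urep a k)).
    by rewrite map_cons_tuple.
  apply: contrapT => /ultraC hn.
  (* One failing index supplies [a0], the default value at indices without a counterexample. *)
  have [k0 /= /existsNP[a0 _]] := UE hn.
  pose S k a := ~ sat phi (cons_tuple a (map_tuple (urep ^~ k) t)).
  have /choice[f hf] k : exists b, (exists a, S k a) -> S k b.
    by have [[a ha]|ha] := pselect (exists a, S k a); [exists a|exists a0].
  have := h (uclass f); rewrite IH => h1.
  have /UE[k [[/=]]] := UI (UI hn h1) (uclassK f).
  by rewrite map_cons_tuple => /existsNP /hf h2 h3 E; apply: h2; rewrite -E.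
Qed.

(** A tuple has finitely many entries, so the chosen representatives agree with the given functions
    simultaneously on one set of [U]. *)
Lemma los_class n (phi : formula V n) (t : n.-tuple (nat -> M)) :
  sat (M := ultrapower) phi (map_tuple uclass t) <->
  U [set k | sat phi (map_tuple (@^~ k) t)].
Proof.
have h : U [set k | forall i : 'I_n, urep (uclass (tnth t i)) k = tnth t i k].
  have: forall s : seq 'I_n, U [set k | forall i, i \in s -> urep (uclass (tnth t i)) k = tnth t i k].
    elim=> [|i s IH]; first by apply: UT.
    apply: US (UI (uclassK (tnth t i)) IH) => k /= [E h] j.
    by rewrite in_cons => /predU1P[->|/h].
  by move/(_ (enum 'I_n)); apply: US => k h i; apply: h; rewrite mem_enum.
have E k : (forall i : 'I_n, urep (uclass (tnth t i)) k = tnth t i k) ->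
    map_tuple (urep ^~ k) (map_tuple uclass t) = map_tuple (@^~ k) t.
  by move=> hk; rewrite map_tuple_comp; apply: eq_map_tuple => i /=.
by rewrite los; split=> h1; apply: US (UI h h1) => k /= [/E->].
Qed.

Lemma diag_elementary : elementary (fun a => uclass (fun=> a) : ultrapower).
Proof.
move=> n phi v.
have -> : map_tuple (fun a => uclass (fun=> a) : ultrapower) v =
    map_tuple uclass (map_tuple (fun a _ => a) v).
  by rewrite map_tuple_comp.
rewrite los_class.
have E k : map_tuple (@^~ k) (map_tuple (fun a _ => a) v) = v.
  by rewrite map_tuple_comp map_tuple_id.
split=> [h|/UE[k /=]]; last by rewrite E.
by apply: UT => k /=; rewrite E.
Qed.

End Ultrapower.

Lemma nonprincipal_ultrafilter :
  exists U : set_system nat, UltraFilter U /\ eventually `<=` U.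
Proof. exact: ultraFilterLemma. Qed.

(** * The Tarski-Vaught construction *)

Lemma countable_enum (T : Type) (x0 : T) :
  countable [set: T] -> exists e : nat -> T, forall x, exists k, e k = x.
Proof.
move=> /countable_injP[f finj].
have /choice[e he] k : exists y, forall x, f x = k -> x = y.
  have [[x hx]|hn] := pselect (exists x, f x = k); last first.
    by exists x0 => x hx; case: hn; exists x.
  by exists x => y hy; apply: finj; rewrite ?inE // hx.
by exists e => x; exists (f x); rewrite -(he _ x erefl).
Qed.

Section TarskiVaught.
Variables (V : vocabulary) (N : structure V).

(* Henkin-style bookkeeping inside [N]: step [k] serves the request coded by the
   2-adic valuation of [k.+1], so that every request is served infinitely often. *)
Lemma tarski_vaught_sequence (P : seq N -> Prop) (s0 : seq N) :
  inhabited N -> P s0 ->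
  (forall s (phi : formula V (size s).+1), P s ->
    (exists a, sat phi (cons_tuple a (in_tuple s))) ->
    exists a, sat phi (cons_tuple a (in_tuple s)) /\ P (rcons s a)) ->
  exists b : nat -> N,
    [/\ mkseq b (size s0) = s0,
        forall k, size s0 <= k -> P (mkseq b k) &
        forall n (phi : formula V n.+1) (t : n.-tuple nat),
          (exists a, sat phi (cons_tuple a (map_tuple b t))) ->
          exists j, sat phi (cons_tuple (b j) (map_tuple b t))].
Proof.
move=> [x0] P0 Hstep.
have en n := cid (countable_enum (FTop V n.+1) (@countable_formula V n.+1)).
pose e n := projT1 (en n).
have he n : forall x, exists k, e n k = x := projT2 (en n).
pose task k : nat * nat * seq nat := odflt (0, 0, [::]) (unpickle (logn 2 k.+1)).
(* Parameters of a request are positions in [s], shifted by one because variable 0 is the element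
   sought. Positions beyond the end of [s] get a junk value from [inord], harmless since the request
   is later met at a large enough step. *)
pose psi (s : seq N) (k : nat) : formula V (size s).+1 :=
  rename (e (task k).1.1 (task k).1.2)
    (cons_tuple ord0 [tuple inord (nth 0 (task k).2 i).+1 | i < (task k).1.1]).
have /choice[g hg] (sk : seq N * nat) : exists a, P sk.1 -> P (rcons sk.1 a) /\
    ((exists c, sat (psi sk.1 sk.2) (cons_tuple c (in_tuple sk.1))) ->
      sat (psi sk.1 sk.2) (cons_tuple a (in_tuple sk.1))).
  have [Ps|nPs] := pselect (P sk.1); last by exists x0.
  have [ex|nex] := pselect (exists c, sat (psi sk.1 sk.2) (cons_tuple c (in_tuple sk.1))).
    by have [a [h1 h2]] := Hstep _ _ Ps ex; exists a.
  (* If the request has no solution, the trivial formula still yields an element that preserves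
     [P]. *)
  have [|a [_ h2]] := Hstep _ (FTop V _) Ps; first by exists x0 => h.
  by exists a.
pose S := fix S k := if k is k'.+1 then rcons (S k') (g (S k', k')) else s0.
have sizeS k : size (S k) = size s0 + k.
  by elim: k => [|k IH] /=; rewrite ?addn0 // size_rcons IH addnS.
have PS k : P (S k).
  by elim: k => [//|k IH] /=; have [] := hg (S k, k) IH.
have nthS k j i : i < size (S k) -> nth x0 (S (k + j)) i = nth x0 (S k) i.
  move=> hi; elim: j => [|j IH]; first by rewrite addn0.
  rewrite addnS /= nth_rcons sizeS (leq_trans hi) ?IH //.
  by rewrite sizeS leq_add2l leq_addr.
pose b i := nth x0 (S i.+1) i.
have nthb k i : i < size (S k) -> nth x0 (S k) i = b i.
  move=> hi; have hi' : i < size (S i.+1) by rewrite sizeS addnS ltnS leq_addl.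
  have [le|/ltnW le] := leqP k i.+1.
    by rewrite /b -(subnKC le) nthS.
  by rewrite -(subnKC le) nthS.
have Sb k : S k = mkseq b (size s0 + k).
  apply: (@eq_from_nth _ x0) => [|i hi]; first by rewrite size_mkseq sizeS.
  by rewrite nthb // nth_mkseq // -sizeS.
exists b; split=> [|k hk|n phi t [c hc]].
- by have := Sb 0; rewrite addn0.
- by rewrite -(subnKC hk) -Sb.
have [j hj] := he n phi.
pose a := pickle (n, j, val t).
pose B := \max_(i < n) tnth t i.
(* Here [k.+1] is [2 ^ a] times an odd number, so step [k] serves the request coded by [a]; the odd
   factor makes [k] exceed every parameter of the request. *)
pose k := (2 ^ a * (B.+1).*2.+1).-1.
have k1 : k.+1 = (2 ^ a * (B.+1).*2.+1) by rewrite prednK // muln_gt0 expn_gt0.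
have taskk : task k = (n, j, val t).
  rewrite /task k1 lognM ?expn_gt0 // pfactorK // logn_coprime ?addn0 ?pickleK //.
  by rewrite coprime2n /= odd_double.
have Bk : B < k.
  rewrite -ltnS k1; apply: leq_trans (leq_pmull _ _); last by rewrite expn_gt0.
  by rewrite ltnS -addnn leq_addr.
have tk i : tnth t i < size (S k).
  rewrite sizeS; apply: leq_trans (leq_addl _ _); apply: leq_ltn_trans Bk.
  exact: (leq_bigmax i).
have satpsi d : sat (psi (S k) k) (cons_tuple d (in_tuple (S k))) <->
    sat phi (cons_tuple d (map_tuple b t)).
  rewrite /psi taskk /= hj sat_rename map_cons_tuple tnth0.
  rewrite (_ : map_tuple _ _ = map_tuple b t) //; apply: eq_from_tnth => i.
  rewrite !tnth_map tnth_ord_tuple -(tnth_nth 0 t i).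
  rewrite (tnth_nth x0) inordK ?ltnS ?tk //=; exact: nthb.
(* Step [k] appends its answer at this position, which is [size s0 + k]. *)
exists (size (S k)).
have -> : b (size (S k)) = g (S k, k).
  rewrite -(nthb k.+1) /= ?size_rcons // nth_rcons ltnn eqxx //.
by apply/satpsi; have [_ /=] := hg (S k, k) (PS k); apply; exists c; apply/satpsi.
Qed.

(** The Tarski-Vaught test: a counterexample in [N] to a universal formula can be replaced by one in
    the range of [b]. *)
Lemma elementary_range (b : nat -> N) :
  (forall n (phi : formula V n.+1) (t : n.-tuple nat),
     (exists a, sat phi (cons_tuple a (map_tuple b t))) ->
     exists j, sat phi (cons_tuple (b j) (map_tuple b t))) ->
  elementary (@proj1_sig _ (range b) : substructure (range b) -> N).
Proof.
move=> tv n phi.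
elim: phi => {n} [n|n i j|n R u|n phi IH1 psi IH2|n phi IH] v //=.
- rewrite !tnth_map; split=> [->//|h]; case: (tnth v i) (tnth v j) h => [x hx] [y hy] /= xy.
  exact: eq_exist.
- by rewrite map_tuple_tnth.
- by rewrite IH1 IH2.
split=> [h a|h a]; last by rewrite IH map_cons_tuple.
have /choice[j hj] (x : substructure (range b)) : exists j, b j = proj1_sig x.
  by have [j _ hj] := proj2_sig x; exists j.
have E : map_tuple (@proj1_sig _ _) v = map_tuple b (map_tuple j v).
  by rewrite map_tuple_comp; apply: eq_map_tuple => i; rewrite /= hj.
apply: contrapT => ha.
have [|k] := tv n (FNot phi) (map_tuple j v); first by exists a; rewrite -E.
rewrite -E; apply.
have := h (exist _ (b k) (ex_intro2 _ _ k I erefl)).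
by rewrite IH map_cons_tuple.
Qed.

End TarskiVaught.

(** * Types in omega-categorical structures *)

Lemma tuple_reindex (A : Type) n m (w : n.-tuple A) (v : m.-tuple A) :
  (forall i, exists j, tnth w i = tnth v j) ->
  exists r : n.-tuple 'I_m, w = map_tuple (tnth v) r.
Proof.
move=> /choice[f hf]; exists [tuple f i | i < n].
by apply: eq_from_tnth => i; rewrite tnth_map tnth_mktuple.
Qed.

Lemma infinite_notin_tuple (T : Type) n (v : n.-tuple T) :
  infinite_set [set: T] -> exists a, forall i, a <> tnth v i.
Proof.
move=> hinf; apply: contrapT => hn; apply: hinf.
apply/(@finite_seqP {classic T}); exists (val v : seq {classic T}).
apply/seteqP; split=> // x _ /=.
apply: contrapT => xv; apply: hn; exists x => i xi; apply: xv.
by rewrite xi; apply: (@mem_tnth _ {classic T}).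
Qed.

Lemma countably_infinite_infinite (T : Type) :
  countably_infinite T -> infinite_set [set: T].
Proof. by move=> h; rewrite (eq_finite_set h); exact: infinite_nat. Qed.

Lemma countably_infinite_enum (T : Type) n :
  countably_infinite T -> exists e : nat -> n.-tuple T, forall v, exists k, e k = v.
Proof.
move=> h; have hc : countable [set: T] by rewrite (eq_countable h).
have [x _] := infinite_setN0 (countably_infinite_infinite h).
apply: (countable_enum (nseq_tuple n x)).
have /countable_injP[f finj] := hc.
apply/countable_injP; exists (fun v => pickle (map_tuple f v)) => v w _ _ /(pcan_inj pickleK) E.
apply: eq_from_tnth => i; have := congr1 (fun u => tnth u i) E; rewrite !tnth_map.
by apply: finj; rewrite inE.
Qed.

(** If the range were a finite list, differing from all its entries would be a formula with
    parameters in the range, solvable in [N] and hence by some [b k]. *)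
Lemma range_infinite (V : vocabulary) (N : structure V) (b : nat -> N) :
  infinite_set [set: N] ->
  (forall n (phi : formula V n.+1) (t : n.-tuple nat),
     (exists a, sat phi (cons_tuple a (map_tuple b t))) ->
     exists j, sat phi (cons_tuple (b j) (map_tuple b t))) ->
  infinite_set (range b).
Proof.
move=> hinf tv /(@finite_seqP {classic N})[s sE].
have /choice[j hj] (i : 'I_(size s)) : exists j, b j = tnth (in_tuple s) i.
  have : range b (tnth (in_tuple s) i).
    by rewrite sE /=; apply: (@mem_tnth _ {classic N}).
  by case=> k _ <-; exists k.
have E : map_tuple b [tuple j i | i < size s] = in_tuple s.
  by apply: eq_from_tnth => i; rewrite tnth_map tnth_mktuple hj.
have [a ha] := infinite_notin_tuple (in_tuple s : (size s).-tuple N) hinf.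
have [|k] := tv _ (FConj (enum 'I_(size s)) (fun i => FNot (FEq V ord0 (lift ord0 i))))
  [tuple j i | i < size s].
  exists a; rewrite E sat_conj => i _ /=; rewrite tnthS tnth0 => H; exact: ha H.
rewrite E sat_conj => h.
have : [set` s] (b k) by rewrite -sE; exists k.
move=> /= /(@seq_tnthP {classic N})[i bki].
by have := h i; rewrite mem_enum /= tnthS tnth0 => /(_ isT); apply.
Qed.

Section OmegaCategorical.
Variables (V : vocabulary) (M : structure V).
Hypothesis hcount : countably_infinite M.
Hypothesis hcat : omega_categorical M.

Lemma countable_models_iso (N : structure V) :
  countably_infinite N -> models N (Th M) -> exists f : N -> M, isomorphism f.
Proof.
move=> cN mN; have [N0 [_ _ h]] := hcat.
have [f fiso] := h N cN mN.
have [|g giso] := h M hcount; first by [].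
have [g' [g'iso _ _]] := isomorphism_inv giso.
by exists (g' \o f); exact: isomorphism_comp.
Qed.

(** Downward Loewenheim-Skolem with an invariant [P] on initial segments. The range of the sequence
    is a countably infinite elementary substructure of [N], so omega-categoricity makes it a copy of
    [M]. *)
Lemma elementary_along (N : structure V) (P : seq N -> Prop) (s0 : seq N) :
  infinite_set [set: N] -> models N (Th M) -> P s0 ->
  (forall s (phi : formula V (size s).+1), P s ->
    (exists a, sat phi (cons_tuple a (in_tuple s))) ->
    exists a, sat phi (cons_tuple a (in_tuple s)) /\ P (rcons s a)) ->
  exists (f : M -> N) (b : nat -> N),
    [/\ elementary f, range f = range b, mkseq b (size s0) = s0 &
        forall k, size s0 <= k -> P (mkseq b k)].
Proof.
move=> infN mN P0 Hstep.
have inh : inhabited N by have [x _] := infinite_setN0 infN; exists.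
have [b [b0 bP tv]] := tarski_vaught_sequence inh P0 Hstep.
have el := elementary_range tv.
have infb := range_infinite infN tv.
pose S := substructure (range b).
have sval_inj : injective (@proj1_sig _ (range b)).
  by move=> [x hx] [y hy] /= xy; exact: eq_exist.
have cS : countably_infinite S.
  have E : [set @proj1_sig _ _ x | x in [set: S]] = range b.
    apply/seteqP; split=> [_ [x _ <-]|x hx]; first exact: proj2_sig.
    by exists (exist _ x hx).
  have := inj_card_eq (A := [set: S]) (in2W sval_inj).
  rewrite E => /card_esym/card_eq_trans; apply.
  by apply: eq_card_nat => //; apply: card_le_trans (card_image_le _ _) _; exact: countableP.
have mS : models S (Th M).
  by move=> phi /mN; apply: elementary_models_inv el phi.
have [h hiso] := countable_models_iso cS mS.
have [g [giso hK gK]] := isomorphism_inv hiso.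
exists (@proj1_sig _ (range b) \o g), b; split=> //.
  move=> n phi v; rewrite (iso_elementary giso) el.
  by rewrite (_ : map_tuple _ (map_tuple g v) = map_tuple (@proj1_sig _ _ \o g) v) // map_tuple_comp.
apply/seteqP; split=> [_ [x _ <-]|x hx]; first exact: proj2_sig.
by exists (h (exist _ x hx)); rewrite //= hK.
Qed.

(** The class of a sequence of partial realizations satisfies every [F j] in the ultrapower. A copy
    of [M] elementarily embedded there, built to contain this tuple, brings the realization back to
    [M]. *)
Lemma realize_chain n (F : nat -> formula V n) :
  (forall k, exists v : n.-tuple M, forall j, j <= k -> sat (F j) v) ->
  exists v : n.-tuple M, forall j, sat (F j) v.
Proof.
move=> /choice[w hw].
have [U [UU Uoo]] := nonprincipal_ultrafilter.
pose c : n.-tuple (ultrapower M U) :=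
  map_tuple (@uclass V M U) [tuple (fun k => tnth (w k) i) | i < n].
have cF j : sat (F j) c.
  rewrite /c los_class; apply: Uoo; exists j => // k /= jk.
  rewrite (_ : map_tuple _ _ = w k); first exact: hw.
  by apply: eq_from_tnth => i; rewrite tnth_map tnth_mktuple.
have infU : infinite_set [set: ultrapower M U].
  have dinj := proj1 (elementary_embedding (@diag_elementary V M U UU)).
  move=> /(sub_finite_set (@subsetT _ (range (fun a => uclass U (fun=> a))))).
  rewrite (eq_finite_set (inj_card_eq (in2W dinj))).
  exact: countably_infinite_infinite hcount.
have [] := @elementary_along (ultrapower M U) (fun=> True) (val c) infU _ I.
- exact: elementary_models (@diag_elementary V M U UU).
- by move=> s phi _ [a ha]; exists a.
move=> f [b [fe fb bc _]].
have /choice[v hv] (i : 'I_n) : exists x, f x = tnth c i.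
  have : range b (tnth c i).
    rewrite (tnth_nth (tnth c i)) -bc nth_mkseq ?size_tuple //; by exists (val i).
  by rewrite -fb => -[x _ <-]; exists x.
exists [tuple v i | i < n] => j; rewrite fe (_ : map_tuple _ _ = c) //.
by apply: eq_from_tnth => i; rewrite tnth_map tnth_mktuple.
Qed.

Definition isolated n (v : n.-tuple M) :=
  exists theta : formula V n, sat theta v /\
    forall w : n.-tuple M, sat theta w -> eqtp v w.

Lemma isolated_reindex n m (v : m.-tuple M) (r : n.-tuple 'I_m) :
  isolated v -> isolated (map_tuple (tnth v) r).
Proof.
move=> [theta [hv hw]]; have [psi hpsi] := FProj theta r.
exists psi; split; first by rewrite hpsi; exists v.
by move=> w; rewrite hpsi => -[y [hy ->]]; apply: eqtp_reindex; exact: hw.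
Qed.

(** Omitting types. Otherwise every satisfiable formula implying [phi] could be strengthened to
    exclude any prescribed tuple. Doing so along an enumeration of all tuples gives a chain that
    [realize_chain] realizes by a tuple outside the enumeration. *)
Lemma isolated_dense n (phi : formula V n) :
  (exists v : n.-tuple M, sat phi v) ->
  exists v : n.-tuple M, sat phi v /\ isolated v.
Proof.
move=> satphi; apply: contrapT => hn.
have [e he] := countably_infinite_enum n hcount.
pose ok psi := (exists v : n.-tuple M, sat psi v) /\
  forall v : n.-tuple M, sat psi v -> sat phi v.
have /choice[G hG] (pk : formula V n * nat) : exists psi', ok pk.1 ->
    [/\ ok psi', forall v : n.-tuple M, sat psi' v -> sat pk.1 v & ~ sat psi' (e pk.2)].
  case: pk => psi k /=.
  have [okpsi|] := pselect (ok psi); last by exists psi.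
  have [sk|] := pselect (sat psi (e k)); last by exists psi.
  have nis : ~ isolated (e k).
    by move=> his; apply: hn; exists (e k); split=> //; apply: (proj2 okpsi).
  have [w [sw nw]] : exists w : n.-tuple M, sat psi w /\ ~ eqtp (e k) w.
    apply: contrapT => hw; apply: nis; exists psi; split=> // w sw.
    by apply: contrapT => nw; apply: hw; exists w.
  have [chi [cw ck]] : exists chi, sat chi w /\ ~ sat chi (e k).
    move/existsNP: nw => [chi nchi].
    have [ck|ck] := pselect (sat chi (e k)).
      exists (FNot chi); split; last by move=> /=; apply.
      by move=> cw; apply: nchi.
    exists chi; split=> //; apply: contrapT => cw; apply: nchi; by split.
  exists (FAnd psi chi) => _; split.
  - split; first by exists w; apply/sat_and.
    by move=> v /sat_and[+ _]; apply: (proj2 okpsi).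
  - by move=> v /sat_and[].
  - by move=> /sat_and[_ /ck].
pose Psi := fix Psi k := if k is k'.+1 then G (Psi k', k') else phi.
have okP k : ok (Psi k).
  by elim: k => [//|k IH] /=; have [] := hG (Psi k, k) IH.
have mono j k (v : n.-tuple M) : j <= k -> sat (Psi k) v -> sat (Psi j) v.
  elim: k => [|k IH]; first by rewrite leqn0 => /eqP->.
  rewrite leq_eqVlt => /predU1P[->//|]; rewrite ltnS => /IH h hv; apply: h.
  by have [_ h _] := hG (Psi k, k) (okP k); apply: h.
have [k|v hv] := @realize_chain n Psi.
  by have [[v sv] _] := okP k; exists v => j jk; exact: mono sv.
have [k ek] := he v.
by have [_ _] := hG (Psi k, k) (okP k); apply; rewrite /= ek; exact: (hv k.+1).
Qed.

(** Take an isolated solution [v] of [phi] whose tail satisfies the formula isolating [s]. That tail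
    has the type of [s], so a first entry with the same properties exists over [s] itself. *)
Lemma isolated_rcons (s : seq M) (phi : formula V (size s).+1) :
  isolated (in_tuple s) -> (exists a, sat phi (cons_tuple a (in_tuple s))) ->
  exists a, sat phi (cons_tuple a (in_tuple s)) /\ isolated (in_tuple (rcons s a)).
Proof.
move=> [theta [hs hth]] [a ha].
pose sh := [tuple lift ord0 i | i < size s].
have shE b (w : (size s).-tuple M) : map_tuple (tnth (cons_tuple b w)) sh = w.
  by apply: eq_from_tnth => i; rewrite tnth_map tnth_mktuple tnthS.
have [|v [/sat_and[v1 v2] [chi [cv chiv]]]] := @isolated_dense _ (FAnd phi (rename theta sh)).
  by exists (cons_tuple a (in_tuple s)); apply/sat_and; rewrite sat_rename shE.
have vE : v = cons_tuple (thead v) (behead_tuple v).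
  by rewrite {1}(tuple_eta v); exact: val_inj.
rewrite vE sat_rename shE in v2.
have [b /sat_and[b1 b2]] : exists b, sat (FAnd phi chi) (cons_tuple b (in_tuple s)).
  apply/sat_ex; rewrite (hth _ v2) sat_ex; exists (thead v); apply/sat_and.
  by rewrite -vE.
exists b; split=> //.
have : isolated (cons_tuple b (in_tuple s)).
  by exists chi; split=> // w hw; apply: eqtp_trans (eqtp_sym (chiv _ b2)) (chiv _ hw).
have [r ->] : exists r, in_tuple (rcons s b) =
    map_tuple (tnth (cons_tuple b (in_tuple s))) r; last exact: isolated_reindex.
apply: tuple_reindex => i.
have [|si] := ltnP i (size s); [move=> si|].
  exists (lift ord0 (Ordinal si)).
  by rewrite tnthS !(tnth_nth b) /= nth_rcons si.
exists ord0; rewrite tnth0 (tnth_nth b) /= nth_rcons ltnNge si /=.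
by case: eqP.
Qed.

(** Build an elementary map of [M] into itself whose image is enumerated with all initial segments
    isolated. The image of [v] lies in such a segment, and elementarity pulls isolation back to
    [v]. *)
Lemma all_isolated n (v : n.-tuple M) : isolated v.
Proof.
have [] := @elementary_along M (fun s => isolated (in_tuple s)) [::] (countably_infinite_infinite hcount).
- by [].
- exists (FTop V 0); split; first by move=> h.
  by move=> w _; rewrite (tuple0 w) (tuple0 (in_tuple [::])).
- by move=> s phi; exact: isolated_rcons.
move=> f [b [fe fb _ bis]].
have /choice[j hj] x : exists j, b j = f x.
  have : range b (f x) by rewrite -fb; exists x.
  by case=> j _ <-; exists j.
pose K := (\max_(i < n) j (tnth v i)).+1.
have [theta [hth hth']] : isolated (map_tuple f v).
  have [r ->] : exists r, map_tuple f v = map_tuple (tnth (in_tuple (mkseq b K))) r.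
    apply: tuple_reindex => i.
    have hi : j (tnth v i) < size (mkseq b K) by rewrite size_mkseq ltnS (leq_bigmax i).
    exists (Ordinal hi).
    rewrite [RHS](tnth_nth (b 0)) nth_mkseq; last by move: (hi); rewrite size_mkseq.
    by rewrite tnth_map hj.
  by apply: isolated_reindex; exact: bis.
exists theta; split=> [|w hw]; first exact/fe.
have h := hth' _ (proj1 (fe _ _ _) hw).
by move=> phi; rewrite (fe _ phi v) (fe _ phi w); exact: h.
Qed.

(** If no finite number of isolating formulas covered all tuples, [realize_chain] would realize all
    their negations at once, although every tuple satisfies its own isolating formula. *)
Lemma finitely_many_types n :
  exists (m : nat) (psi : 'I_m -> formula V n),
    (forall v : n.-tuple M, exists i, sat (psi i) v) /\
    (forall i (v w : n.-tuple M), sat (psi i) v -> sat (psi i) w -> eqtp v w).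
Proof.
have [e he] := countably_infinite_enum n hcount.
have /choice[psi hpsi] k := all_isolated (e k).
have [m hm] : exists m, forall v : n.-tuple M, exists2 i, i < m & sat (psi i) v.
  apply: contrapT => /forallNP hn.
  have [k|v hv] := @realize_chain n (fun k => FNot (psi k)).
    have /existsNP[v hv] := hn k.+1.
    by exists v => j jk /= sj; apply: hv; exists j.
  have [k ek] := he v; apply: (hv k); rewrite -ek; exact: (proj1 (hpsi k)).
exists m, psi; split=> [v|i v w].
  by have [i im si] := hm v; exists (Ordinal im).
move=> h1 h2; have [_ h] := hpsi i.
exact: eqtp_trans (eqtp_sym (h _ h1)) (h _ h2).
Qed.

End OmegaCategorical.

(** * Automorphisms and sets determining types *)

Section Automorphisms.
Variables (V : vocabulary) (M : structure V).
Hypothesis hcount : countably_infinite M.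
Hypothesis hcat : omega_categorical M.

(** That the formula isolating the type of [a] with [v] has a solution over [v] is itself part of
    the type of [v]. *)
Lemma eqtp_extend n (v w : n.-tuple M) a :
  eqtp v w -> exists b, eqtp (cons_tuple a v) (cons_tuple b w).
Proof.
move=> vw; have [chi [hchi hchi']] := all_isolated hcount hcat (cons_tuple a v).
have /sat_ex[b hb] : sat (FEx chi) w by apply/vw/sat_ex; exists a.
by exists b; apply: hchi'.
Qed.

(** Finite partial elementary maps, stored as lists of argument-value pairs. *)
Definition elementary_pairs (p : seq (M * M)) :=
  eqtp (map_tuple fst (in_tuple p)) (map_tuple snd (in_tuple p)).

Lemma elementary_pairs_extend p x : elementary_pairs p ->
  exists ab : M * M, elementary_pairs [:: (ab.1, x), (x, ab.2) & p].
Proof.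
move=> hp; have [b hb] := eqtp_extend x hp.
have [a ha] := eqtp_extend x (eqtp_sym hb).
exists (a, b); rewrite /elementary_pairs /=.
have -> : map_tuple fst (in_tuple [:: (a, x), (x, b) & p]) =
    cons_tuple a (cons_tuple x (map_tuple fst (in_tuple p))) by exact: val_inj.
have -> : map_tuple snd (in_tuple [:: (a, x), (x, b) & p]) =
    cons_tuple x (cons_tuple b (map_tuple snd (in_tuple p))) by exact: val_inj.
exact: eqtp_sym.
Qed.

Lemma elementary_pairs_mem (p : seq {classic (M * M)}) n (t : n.-tuple (M * M)) :
  elementary_pairs p -> (forall i, tnth t i \in p) ->
  eqtp (map_tuple fst t) (map_tuple snd t).
Proof.
move=> hp tp.
have [r ->] : exists r, t = map_tuple (tnth (in_tuple (p : seq (M * M)))) r.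
  by apply: tuple_reindex => i; have [j ij] := seq_tnthP (tp i); exists j.
by rewrite !map_tuple_tnth; exact: eqtp_reindex.
Qed.

(** Back-and-forth: stage [k] puts [e k] into both the domain and the range, and the union [G] of
    the stages is the graph of an elementary bijection. *)
Lemma eqtp_automorphism n (v w : n.-tuple M) :
  eqtp v w -> exists s : M -> M, isomorphism s /\ map_tuple s v = w.
Proof.
move=> vw.
have [e1 he1] := countably_infinite_enum 1 hcount.
pose e k := thead (e1 k).
have he x : exists k, e k = x.
  by have [k ek] := he1 [tuple x]; exists k; rewrite /e ek theadE.
pose p0 : seq (M * M) := [tuple (tnth v i, tnth w i) | i < n].
have hp0 : elementary_pairs p0.
  have [r hr] : exists r, in_tuple p0 =
      map_tuple (tnth [tuple (tnth v i, tnth w i) | i < n]) r.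
    apply: tuple_reindex => i; apply/(@tnthP _ {classic (M * M)}).
    exact: (@mem_tnth _ {classic (M * M)} i (in_tuple p0)).
  rewrite /elementary_pairs hr !map_tuple_tnth.
  have -> : map_tuple fst [tuple (tnth v i, tnth w i) | i < n] = v.
    by apply: eq_from_tnth => i; rewrite tnth_map tnth_mktuple.
  have -> : map_tuple snd [tuple (tnth v i, tnth w i) | i < n] = w.
    by apply: eq_from_tnth => i; rewrite tnth_map tnth_mktuple.
  exact: eqtp_reindex.
have /choice[g hg] (px : seq (M * M) * M) : exists ab : M * M, elementary_pairs px.1 ->
    elementary_pairs [:: (ab.1, px.2), (px.2, ab.2) & px.1].
  have [hp|hp] := pselect (elementary_pairs px.1); last by exists (px.2, px.2).
  by have [ab hab] := elementary_pairs_extend px.2 hp; exists ab.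
pose S := fix S k : seq {classic (M * M)} := if k is k'.+1 then
  let ab := g (S k', e k') in [:: (ab.1, e k'), (e k', ab.2) & S k'] else p0.
have hS k : elementary_pairs (S k).
  by elim: k => [//|k IH] /=; exact: (hg (S k, e k)).
have Smono j k : j <= k -> {subset S j <= S k}.
  elim: k => [|k IH]; first by rewrite leqn0 => /eqP->.
  rewrite leq_eqVlt => /predU1P[->//|]; rewrite ltnS => /IH h z /h hz.
  by rewrite /= !in_cons hz !orbT.
pose G (z : {classic (M * M)}) := exists k, z \in S k.
have elG m (t : m.-tuple (M * M)) : (forall i, G (tnth t i)) ->
    eqtp (map_tuple fst t) (map_tuple snd t).
  move=> /choice[k hk]; apply: (elementary_pairs_mem (hS (\max_(i < m) k i))) => i.
  exact: Smono (leq_bigmax i) _ (hk i).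
have Gl x : exists y, G (x, y).
  have [k <-] := he x; exists (g (S k, e k)).2, k.+1.
  by rewrite /= !in_cons eqxx orbT.
have Gr y : exists x, G (x, y).
  have [k <-] := he y; exists (g (S k, e k)).1, k.+1.
  by rewrite /= !in_cons eqxx.
(* Equality is a formula, so elementarity of [G] already makes it single-valued. *)
have Gf x y z : G (x, y) -> G (x, z) -> y = z.
  move=> xy xz; have := elG 2 [tuple (x, y); (x, z)].
  move=> h; have {}h := h _ (FEq V ord0 (lift ord0 ord0)).
  move: h => /=; rewrite !tnth_map !tnthS !tnth0 /= => h; apply/h => //.
  by case; case=> [|[|//]] hi; rewrite (tnth_nth (x, y)).
have /choice[s hs] := Gl; have /choice[s' hs'] := Gr.
have se : elementary s.
  move=> m phi u; have := elG m (map_tuple (fun x => (x, s x)) u).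
  rewrite !map_tuple_comp => h; have {}h := h _ phi.
  rewrite -[in X in X <-> _](@map_tuple_id _ _ (fst \o (fun x => (x, s x))) u) //.
  by apply: h => i; rewrite tnth_map; exact: hs.
have semb := elementary_embedding se.
have sK y : s (s' y) = y by apply: Gf (hs _) (hs' _).
exists s; split; first by split=> //; exists s' => // x; apply: semb.1; rewrite sK.
apply: eq_from_tnth => i; rewrite tnth_map; apply: (Gf _ _ _ (hs _)).
exists 0 => /=; apply/(@tnthP _ {classic (M * M)}); exists i.
by rewrite tnth_mktuple.
Qed.

(** The map is total but unconstrained off [X]; thus a sequence of such maps on growing sets defines
    a map into an ultrapower. *)
Definition partial_embedding (X : set M) (e : M -> M) :=
  (forall x y, X x -> X y -> e x = e y -> x = y) /\
  (forall (R : rel_sym V) (t : (arity R).-tuple M),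
    (forall i, X (tnth t i)) -> interp t <-> interp (map_tuple e t)).

(** A semantic counterpart of an existential formula isolating the type of [v]: the remaining
    members of [s] play the part of the quantified witnesses. *)
Definition pins (s : seq {classic M}) n (v : n.-tuple M) :=
  (forall i, tnth v i \in s) /\
  forall e, partial_embedding [set` s] e -> eqtp v (map_tuple e v).

Hypothesis hmc : model_complete M.

(* If no finite set pins down the type of [v], counterexamples [e k] on larger and
   larger finite sets assemble to an embedding of [M] into an ultrapower of [M],
   which model completeness makes elementary. *)
Lemma type_witness n (v : n.-tuple M) :
  exists s : seq {classic M}, pins s v.
Proof.
have [e1 he1] := countably_infinite_enum 1 hcount.
pose en k := thead (e1 k).
have hen x : exists k, en k = x.
  by have [k ek] := he1 [tuple x]; exists k; rewrite /en ek theadE.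
have [theta [thv htheta]] := all_isolated hcount hcat v.
apply: contrapT => /forallNP hn.
pose X k : seq {classic M} := @cat {classic M} (val v) (mkseq en k).
(* As [theta] isolates the type of [v], losing that type means violating the single formula [theta],
   which Los's theorem can detect. *)
have /choice[e he] k : exists e, partial_embedding [set` X k] e /\ ~ sat theta (map_tuple e v).
  apply: contrapT => /forallNP h; apply: (hn (X k)); split.
    by move=> i; rewrite /X (@mem_cat {classic M}) (@mem_tnth _ {classic M}).
  move=> e he; apply: htheta; apply: contrapT => nth.
  by apply: (h e).
have hX x : exists j, forall k, j <= k -> [set` X k] x.
  have [j <-] := hen x; exists j.+1 => k jk /=; rewrite /X (@mem_cat {classic M}); apply/orP; right.
  by apply: (@map_f nat {classic M}); rewrite mem_iota.
have hXt m (t : m.-tuple M) : exists j, forall k, j <= k -> forall i, [set` X k] (tnth t i).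
  have /choice[f hf] := hX; exists (\max_(i < m) f (tnth t i)) => k jk i.
  by apply: hf; apply: leq_trans jk; exact: (leq_bigmax i).
have [U [UU Uoo]] := nonprincipal_ultrafilter.
pose E x : ultrapower M U := uclass U (fun k => e k x).
have losE m (phi : formula V m) (t : m.-tuple M) :
    sat phi (map_tuple E t) <-> U [set k | sat phi (map_tuple (e k) t)].
  have -> : map_tuple E t = map_tuple (@uclass V M U) (map_tuple (fun x k => e k x) t).
    by rewrite map_tuple_comp.
  rewrite los_class.
  suff -> : (fun k => sat phi (map_tuple (@^~ k) (map_tuple (fun x k => e k x) t))) =
    (fun k => sat phi (map_tuple (e k) t)) by [].
  by apply/funext => k; rewrite map_tuple_comp.
(* The entries of [t] lie in [X k] for all large [k], so what each [e k] preserves on [X k] is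
   preserved by [E]. *)
have ev m (phi : formula V m) (t : m.-tuple M) :
    (forall k, (forall i, [set` X k] (tnth t i)) -> sat phi t <-> sat phi (map_tuple (e k) t)) ->
    sat phi t <-> sat phi (map_tuple E t).
  move=> h; rewrite losE; have [j hj] := hXt _ t; split=> [ht|ht].
    by apply: Uoo; exists j => // k /= jk; apply/(h k) => //; exact: hj.
  have Uj : U [set k | j <= k] by apply: Uoo; exists j.
  have [k [/= hk jk]] := @filter_ex _ U _ _ (@filterI _ U _ _ _ ht Uj).
  by apply/(h k) => //; exact: hj.
have Eemb : embedding E.
  split=> [x y xy|R t].
    have := ev 2 (FEq V ord0 (lift ord0 ord0)) [tuple x; y].
    rewrite /= !tnth_map !tnthS !tnth0 => h; apply/h => // k hk.
    rewrite !tnth_map !tnthS !tnth0; split=> [->//|].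
    by apply: (proj1 (he k)).1; [exact: (hk ord0)|exact: (hk (lift ord0 ord0))].
  have idt A (u : (arity R).-tuple A) : map_tuple (tnth u) [tuple i | i < arity R] = u.
    by apply: eq_from_tnth => i; rewrite tnth_map tnth_mktuple.
  have := ev _ (FRel [tuple i | i < arity R]) t; rewrite /= !idt; apply => k hk.
  by rewrite !idt; apply: (proj1 (he k)).2.
have mU : models (ultrapower M U) (Th M) by exact: elementary_models (@diag_elementary V M U UU).
have Eel : elementary E by apply: hmc.
have /losE/filter_ex[k /=] : sat theta (map_tuple E v) by rewrite -Eel.
exact: (proj2 (he k)).
Qed.

(** One pinning set is chosen for each of the finitely many types; automorphisms transport it to
    every other tuple of that type without changing the bound on its size. *)
Lemma type_witness_bound n :
  exists m, forall v : n.-tuple M, exists s : seq {classic M},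
    size s <= m /\ pins s v.
Proof.
have [m [psi [hpsi psiE]]] := finitely_many_types hcount hcat n.
have /choice[s hs] i : exists s : seq {classic M}, forall u : n.-tuple M, sat (psi i) u ->
    exists u' : n.-tuple M, eqtp u' u /\ pins s u'.
  have [[u' hu']|hn] := pselect (exists u' : n.-tuple M, sat (psi i) u'); last first.
    by exists [::] => u hu; case: hn; exists u.
  have [s hs] := type_witness u'; exists s => u hu; exists u'; split=> //.
  exact: psiE hu' hu.
exists (\max_(i < m) size (s i)) => v; have [i hi] := hpsi v.
have [u [uv [h1 h2]]] := hs i v hi.
have [f [fiso fu]] := eqtp_automorphism uv.
exists (map f (s i)); split; first by rewrite size_map (leq_bigmax i).
split=> [j|e [einj erel]].
  by rewrite -fu tnth_map; apply: (@map_f {classic M} {classic M}).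
have fs x : [set` s i] x -> [set` (map f (s i) : seq {classic M})] (f x).
  by move=> hx; apply: (@map_f {classic M} {classic M}).
rewrite -fu map_tuple_comp; apply: eqtp_trans (h2 (e \o f) _).
  by rewrite fu; exact: eqtp_sym.
split=> [x y hx hy /= /einj xy|R t ht].
  by apply: fiso.1.1; apply: xy; exact: fs.
rewrite fiso.1.2 erel ?map_tuple_comp // => j; rewrite tnth_map; exact: fs.
Qed.

End Automorphisms.

(** * Amalgamation *)

Section FiniteSubstructures.
Variables (V : vocabulary) (M : structure V).

Lemma embedding_comp (A B C : structure V) (f : A -> B) (g : B -> C) :
  embedding f -> embedding g -> embedding (g \o f).
Proof.
move=> [fi fr] [gi gr]; split; first exact: inj_comp.
by move=> R t; rewrite fr gr map_tuple_comp.
Qed.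

Definition sub_fin (s : seq {classic M}) : fin_structure V :=
  @FinStructure V (seq_sub s) (fun R t => @interp V M R (map_tuple (@ssval _ s) t)).

Definition sub_val (s : seq {classic M}) : sub_fin s -> M := @ssval _ s.

Lemma sub_val_embedding s : embedding (@sub_val s).
Proof. by split=> //; exact: (@val_inj _ _ (seq_sub s)). Qed.

Lemma sub_fin_age s : Age M (sub_fin s).
Proof. by exists (@sub_val s); exact: sub_val_embedding. Qed.

Lemma embedding_sub_fin (B : structure V) (beta : B -> M) (s : seq {classic M}) :
  embedding beta -> (forall x, beta x \in s) ->
  exists i : B -> sub_fin s, embedding i /\ forall x, sub_val (i x) = beta x.
Proof.
move=> [bi br] bs; exists (fun x => SeqSub (bs x)); split=> //; split.
  by move=> x y /(congr1 (@sub_val s)) /bi.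
by move=> R t; rewrite br /= map_tuple_comp.
Qed.

Lemma sub_fin_tuple (s : seq {classic M}) n (t : n.-tuple M) :
  (forall i, tnth t i \in s) -> exists u : n.-tuple (sub_fin s), t = map_tuple (@sub_val s) u.
Proof.
move=> ts; exists [tuple (SeqSub (ts i) : sub_fin s) | i < n].
by apply: eq_from_tnth => i; rewrite tnth_map tnth_mktuple.
Qed.

Lemma card_sub_fin s : card_fin (sub_fin s) <= size s.
Proof.
rewrite /card_fin cardE -(size_map (@ssval _ s)).
apply: uniq_leq_size => [|_ /mapP[x _ ->]]; last exact: ssvalP.
by rewrite (map_inj_uniq (@val_inj _ _ (seq_sub s))) enum_uniq.
Qed.

(** The amalgam is the substructure of [M] on the union of the two images. *)
Lemma amalgam_in (A : structure V) (B C : fin_structure V) (f : A -> B) (g : A -> C)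
    (beta : B -> M) (gamma : C -> M) :
  embedding beta -> embedding gamma -> (forall x, beta (f x) = gamma (g x)) ->
  has_amalgam (Age M) f g.
Proof.
move=> be ge fg.
pose s : seq {classic M} := @cat {classic M} (codom (beta : fin_carrier B -> {classic M}))
  (codom (gamma : fin_carrier C -> {classic M})).
have [|f0 [f0e f0v]] := @embedding_sub_fin B beta s be.
  by move=> x; rewrite /s (@mem_cat {classic M}) (@codom_f _ {classic M}).
have [|g0 [g0e g0v]] := @embedding_sub_fin C gamma s ge.
  by move=> x; rewrite /s (@mem_cat {classic M}) (@codom_f _ {classic M} gamma) orbT.
exists (sub_fin s), f0, g0; split=> //; first exact: sub_fin_age.
by move=> x; apply: (sub_val_embedding s).1; rewrite f0v g0v.
Qed.

Lemma pins_sub (s s' : seq {classic M}) n (v : n.-tuple M) :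
  {subset s <= s'} -> pins s v -> pins s' v.
Proof.
move=> ss [h1 h2]; split=> [i|e [ei er]]; first exact: ss.
apply: h2; split=> [x y hx hy|R t ht]; first by apply: ei; apply: ss.
by apply: er => i; apply: ss; exact: ht.
Qed.

(** Extending [e] by the identity off [s] gives a total map of the kind that [pins] speaks about. *)
Lemma pins_embedding (s : seq {classic M}) n (v : n.-tuple M)
    (e : sub_fin s -> M) (u : n.-tuple (sub_fin s)) :
  pins s v -> embedding e -> v = map_tuple (@sub_val s) u -> eqtp v (map_tuple e u).
Proof.
move=> [_ h] [ei er] vu.
pose e' (x : M) := if pselect (x \in s) is left h then e (SeqSub h) else x.
have e'E (x : sub_fin s) : e' (sub_val x) = e x.
  rewrite /e'; case: pselect => [h'|]; last by case; exact: ssvalP.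
  by congr e; exact: (@val_inj _ _ (seq_sub s)).
have : eqtp v (map_tuple e' v).
  apply: h; split=> [x y xs ys|R t ts].
    rewrite -[x]/(sub_val (SeqSub xs)) -[y]/(sub_val (SeqSub ys)) !e'E => /ei xy.
    by rewrite xy.
  have [t' ->] := sub_fin_tuple ts.
  rewrite map_tuple_comp (_ : map_tuple (e' \o _) t' = map_tuple e t'); first exact: er.
  by apply: eq_map_tuple => i; exact: e'E.
suff -> : map_tuple e' v = map_tuple e u by [].
by rewrite vu map_tuple_comp; apply: eq_map_tuple => i; exact: e'E.
Qed.

Lemma isomorphism_expansion p (ar : 'I_p -> nat) (phi : forall i, formula V (ar i))
    (s : M -> M) :
  isomorphism s ->
  @isomorphism _ (definable_expansion M phi) (definable_expansion M phi) s.
Proof.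
move=> siso; split; last exact: siso.2.
split; first exact: siso.1.1.
case=> [R|i] t; first exact: siso.1.2.
exact: iso_elementary siso _ _ _.
Qed.

Lemma isomorphism_reduct p (ar : 'I_p -> nat) (phi : forall i, formula V (ar i))
    (s : M -> M) :
  @isomorphism _ (definable_expansion M phi) (definable_expansion M phi) s ->
  isomorphism s.
Proof. by move=> [[si sr] sb]; split=> //; split=> // R t; exact: (sr (inl R) t). Qed.

End FiniteSubstructures.

(** * The two implications between SEAP and homogenizability *)

Section Main.
Variables (V : vocabulary) (M : structure V).
Hypothesis hcount : countably_infinite M.
Hypothesis hmc : model_complete M.
Hypothesis hcat : omega_categorical M.

(* If the two images of [A] in [M] satisfy the same relations of a homogeneous
   expansion, an automorphism moves one onto the other. *)
Lemma homogeneous_align p (ar : 'I_p -> nat) (phi : forall i, formula V (ar i))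
    (A : fin_structure V) (f g : A -> M) :
  homogeneous (definable_expansion M phi) -> embedding f -> embedding g ->
  (forall i (a : (ar i).-tuple A),
    sat (phi i) (map_tuple f a) <-> sat (phi i) (map_tuple g a)) ->
  exists s : M -> M, isomorphism s /\ forall x, s (f x) = g x.
Proof.
move=> hom [fi fr] [gi gr] fg.
have /choice[a ha] (x : {x | range f x}) : exists a, f a = proj1_sig x.
  by have [a _ ha] := proj2_sig x; exists a.
have /choice[b hb] (x : {x | range g x}) : exists b, g b = proj1_sig x.
  by have [b _ hb] := proj2_sig x; exists b.
pose h (x : {x | range f x}) : {x | range g x} :=
  exist _ (g (a x)) (ex_intro2 _ _ (a x) I erefl).
have fa c : a (exist _ (f c) (ex_intro2 _ _ c I erefl)) = c by apply: fi; rewrite ha.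
have hiso : @isomorphism _ (substructure (M := definable_expansion M phi) (range f))
    (substructure (M := definable_expansion M phi) (range g)) h.
  split; first split.
  - move=> x y /(congr1 (@proj1_sig _ _)) /= /gi xy; apply: eq_sig_hprop => [z|]; first exact: Prop_irrelevance.
    by rewrite -!ha xy.
  - move=> R t /=.
    have -> : map_tuple (@proj1_sig _ _) t = map_tuple f (map_tuple a t).
      by rewrite map_tuple_comp; apply: eq_map_tuple => i; rewrite /= ha.
    have -> : map_tuple (@proj1_sig _ _) (map_tuple h t) = map_tuple g (map_tuple a t).
      by rewrite !map_tuple_comp.
    case: R t => [R|i] t; last exact: fg.
    by rewrite /= -(fr R) -(gr R).
  - exists (fun y => exist _ (f (b y)) (ex_intro2 _ _ (b y) I erefl)) => [x|y].
      apply: eq_sig_hprop => [z|]; first exact: Prop_irrelevance.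
      by rewrite /= -ha; congr f; apply: gi; rewrite hb.
    apply: eq_sig_hprop => [z|]; first exact: Prop_irrelevance.
    by rewrite /= fa hb.
have finA (k : A -> M) : finite_set (range k) by apply: finite_image; exact: finite_finset.
have [s siso hs] := hom (range f) (range g) (finA f) (finA g) h hiso.
exists s; split; first exact: isomorphism_reduct siso.
by move=> x; rewrite (hs (exist _ (f x) (ex_intro2 _ _ x I erefl))) /= fa.
Qed.

Lemma homogenizable_SEAP : homogenizable M -> SEAP (Age M).
Proof.
move=> [p [ar [phi hom]]].
have /choice[m hm] (i : 'I_p) := type_witness_bound hcount hcat hmc (ar i).
(* [A0] will hold the entries of one tuple of arity [ar i], and each extension will add one set
   pinning a tuple of that arity. *)
exists (\max_(i < p) ar i).+1, (\max_(i < p) m i).+1.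
move=> A B C f g _ [beta be] [gamma ge] fe ge' nam.
(* If both copies of [A] agreed on every [phi i], an automorphism aligning them would amalgamate [B]
   and [C] inside [M]. *)
have [i [a na]] : exists i (a : (ar i).-tuple A),
    ~ (sat (phi i) (map_tuple (beta \o f) a) <-> sat (phi i) (map_tuple (gamma \o g) a)).
  apply: contrapT => hn; apply: nam.
  have [|||s [siso hs]] := @homogeneous_align _ _ phi A (beta \o f) (gamma \o g) hom.
  - exact: embedding_comp.
  - exact: embedding_comp.
  - move=> i a; apply: contrapT => h; apply: hn; by exists i, a.
  by apply: (@amalgam_in _ _ _ _ _ _ _ (s \o beta) gamma) => //; exact: embedding_comp be siso.1.
pose ext (B' : fin_structure V) (b : B' -> M) sB : seq {classic M} :=
  @cat {classic M} (codom (b : fin_carrier B' -> {classic M})) sB.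
have extend (B' : fin_structure V) (b : B' -> M) (v : (ar i).-tuple M) : embedding b ->
    exists s : seq {classic M}, [/\ pins s v, forall x, b x \in s &
      card_fin (sub_fin s) - card_fin B' < (\max_(i < p) m i).+1].
  move=> bemb; have [s [sm sv]] := hm i v; exists (ext B' b s); split.
  - by apply: pins_sub sv => x xs; rewrite /ext (@mem_cat {classic M}) xs orbT.
  - by move=> x; rewrite /ext (@mem_cat {classic M}) (@codom_f _ {classic M}).
  - rewrite ltnS leq_subLR; apply: leq_trans (card_sub_fin _) _.
    rewrite size_cat size_codom leq_add2l; apply: leq_trans sm _; exact: (leq_bigmax i).
have [sB [pB bB cB]] := extend B beta (map_tuple (beta \o f) a) be.
have [sC [pC cC' cC]] := extend C gamma (map_tuple (gamma \o g) a) ge.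
have [iB [iBe iBv]] := embedding_sub_fin be bB.
have [iC [iCe iCv]] := embedding_sub_fin ge cC'.
exists [set x in val a]%SET, (sub_fin sB), (sub_fin sC), iB, iC; split=> //.
- by split; exact: sub_fin_age.
- rewrite ltnS cardsE; apply: leq_trans (card_size _) _.
  by rewrite size_tuple (leq_bigmax i).
(* An amalgam over [A0], embedded in [M] by [d], sends both images of [a] to the same tuple. The
   pinning sets preserve both types on the way, so the two types coincide, against [na]. *)
move=> [D [f0 [g0 [[d de] f0e g0e fg]]]]; apply: na.
have E1 := pins_embedding (u := map_tuple (iB \o f) a) pB (embedding_comp f0e de).
have E2 := pins_embedding (u := map_tuple (iC \o g) a) pC (embedding_comp g0e de).
suff h : eqtp (map_tuple (beta \o f) a) (map_tuple (gamma \o g) a) by exact: h.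
apply: eqtp_trans (E1 _) (eqtp_sym _).
  by rewrite map_tuple_comp; apply: eq_map_tuple => j; rewrite /= iBv.
suff -> : map_tuple (d \o f0) (map_tuple (iB \o f) a) =
    map_tuple (d \o g0) (map_tuple (iC \o g) a).
  by apply: E2; rewrite map_tuple_comp; apply: eq_map_tuple => j; rewrite /= iCv.
rewrite !map_tuple_comp; apply: eq_map_tuple => j /=; congr d.
have aj : [set` [set x in val a]%SET] (tnth a j) by rewrite /= inE mem_tnth.
exact: (fg (exist _ (tnth a j) aj)).
Qed.

Lemma SEAP_homogenizable : SEAP (Age M) -> homogenizable M.
Proof.
move=> [k [m seap]].
have types n : {q : nat & {psi : 'I_q -> formula V n |
    (forall v : n.-tuple M, exists i, sat (psi i) v) /\
    (forall i (v w : n.-tuple M), sat (psi i) v -> sat (psi i) w -> eqtp v w)}}.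
  by have /cid[q /cid hq] := finitely_many_types hcount hcat n; exists q.
pose q n := projT1 (types n).
pose psi n : 'I_(q n) -> formula V n := proj1_sig (projT2 (types n)).
have psiP n := proj2_sig (projT2 (types n)).
(* There is one new relation for each listed type of tuples of length below [k]. *)
pose T : finType := {n : 'I_k & 'I_(q n)}.
pose en (i : 'I_#|T|) : {n : 'I_k & 'I_(q n)} := enum_val i.
pose phi i := psi _ (tagged (en i)).
exists #|T|, (fun i => tag (en i) : nat), phi.
move=> S S' finS _ h hiso.
have [s sS] := (@finite_seqP {classic M} S).1 finS.
pose h' (x : M) : M := if pselect (S x) is left hx then proj1_sig (h (exist _ x hx)) else x.
have h'E x : h' (proj1_sig x) = proj1_sig (h x).
  rewrite /h'; case: pselect => [hx|]; last by case; exact: proj2_sig.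
  by congr (proj1_sig (h _)); case: x hx => x hx hx'; exact: eq_exist.
have hS (x : M) : S x -> exists y : {x | S x}, x = proj1_sig y by move=> hx; exists (exist _ x hx).
have sinS x : x \in s -> S x by rewrite sS.
have Sins x : S x -> x \in s by rewrite sS.
have tS n (t : n.-tuple M) : (forall i, S (tnth t i)) ->
    exists u, t = map_tuple (@proj1_sig M S) u.
  move=> ht; exists [tuple exist S (tnth t i) (ht i) | i < n].
  by apply: eq_from_tnth => i; rewrite tnth_map tnth_mktuple.
have hrel R (t : _.-tuple M) : (forall i, S (tnth t i)) ->
    @interp _ (definable_expansion M phi) R t <->
    @interp _ (definable_expansion M phi) R (map_tuple h' t).
  move=> /tS[u ->].
  have := hiso.1.2 R u => /= ->; rewrite !map_tuple_comp.
  rewrite (_ : map_tuple (h' \o _) u = map_tuple (@proj1_sig _ _ \o h) u) //.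
  by apply: eq_map_tuple => i /=; rewrite h'E.
(* Each short tuple satisfies one of the new relations, [h] preserves that relation, and the
   relation determines the type. *)
have htype n (t : n.-tuple M) : n < k -> (forall i, S (tnth t i)) -> eqtp t (map_tuple h' t).
  move=> nk ht; have [i hi] := (psiP n).1 t.
  apply: ((psiP n).2 i) => //.
  have : forall (x : {n : 'I_k & 'I_(q n)}) (u : (tag x).-tuple M), (forall i, S (tnth u i)) ->
      sat (psi _ (tagged x)) u <-> sat (psi _ (tagged x)) (map_tuple h' u).
    move=> x; have <- : en (enum_rank (x : T)) = x by exact: enum_rankK.
      move=> u hu; exact: (hrel (inr (enum_rank (x : T))) u hu).
  move=> /(_ (Tagged (fun n : 'I_k => 'I_(q n)) (i : 'I_(q (Ordinal nk)))) t ht) H.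
  exact: H.1 hi.
pose v : (size s).-tuple M := in_tuple s.
pose w := map_tuple h' v.
have vS i : tnth v i \in s by exact: (@mem_tnth _ {classic M}).
(* The tuple [v] lists the whole domain of [h], so an automorphism taking [v] to [w] extends [h]. *)
suff /(eqtp_automorphism hcount hcat)[sigma [siso sv]] : eqtp v w.
  exists sigma; first exact: isomorphism_expansion.
  move=> x; rewrite -h'E.
  have /seq_tnthP[j ->] : proj1_sig x \in s by apply: Sins; exact: proj2_sig.
  by have := congr1 (fun u => tnth u j) sv; rewrite !tnth_map.
apply: contrapT => nvw.
(* The sets pinning [v] and [w] serve as [B] and [C] over the domain of [h]: an amalgam would force
   [v] and [w] to have the same type. *)
have [sB pB] := type_witness hcount hcat hmc v.
have [sC pC] := type_witness hcount hcat hmc w.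
have ve := sub_val_embedding s.
have he : embedding (h' \o @sub_val _ _ s).
  split=> [x y /= xy|R t].
    apply: ve.1.
    have [x' xE] := hS _ (sinS _ (ssvalP x)); have [y' yE] := hS _ (sinS _ (ssvalP y)).
    move: xy; rewrite /sub_val xE yE !h'E => xy; congr (proj1_sig _).
    apply: hiso.1.1; move: xy; case: (h x') (h y') => [? ?] [? ?] /=; exact: eq_exist.
  rewrite -map_tuple_comp; apply: (hrel (inl R) (map_tuple (@sub_val _ _ s) t)) => i.
  by rewrite tnth_map; apply: sinS; exact: ssvalP.
have [u vu] := sub_fin_tuple vS.
have memA (x : sub_fin s) : exists j, x = tnth u j.
  have /seq_tnthP[j hj] : sub_val x \in s by exact: ssvalP.
  exists j; apply: ve.1; rewrite hj; have := congr1 (fun z => tnth z j) vu.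
  by rewrite tnth_map.
have wu : w = map_tuple (h' \o @sub_val _ _ s) u by rewrite /w vu map_tuple_comp.
have [|f [fe fv]] := @embedding_sub_fin _ _ (sub_fin s) _ sB ve.
  by move=> x; have [j ->] := memA x; have := pB.1 j; rewrite vu tnth_map.
have [|g [ge gv]] := @embedding_sub_fin _ _ (sub_fin s) _ sC he.
  by move=> x; have [j ->] := memA x; have := pC.1 j; rewrite wu tnth_map.
have vf : v = map_tuple (@sub_val _ _ sB) (map_tuple f u).
  by rewrite vu map_tuple_comp; apply: eq_map_tuple => i; rewrite /= fv.
have wg : w = map_tuple (@sub_val _ _ sC) (map_tuple g u).
  by rewrite wu map_tuple_comp; apply: eq_map_tuple => i; rewrite /= gv.
have nam : ~ has_amalgam (Age M) f g.
  move=> [D [f0 [g0 [[d de] f0e g0e fg]]]]; apply: nvw.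
  have E1 := pins_embedding pB (embedding_comp f0e de) vf.
  have E2 := pins_embedding pC (embedding_comp g0e de) wg.
  apply: eqtp_trans E1 (eqtp_sym _).
  rewrite (_ : map_tuple _ _ = map_tuple (d \o g0) (map_tuple g u)) //.
  by rewrite !map_tuple_comp; apply: eq_map_tuple => i; rewrite /= fg.
have [A0 [B0 [C0 [iB [iC [[[eB eBe] [eC eCe]] [iBe iCe] A0k _ nam0]]]]]] :=
  seap (sub_fin s) (sub_fin sB) (sub_fin sC) f g
    (sub_fin_age s) (sub_fin_age sB) (sub_fin_age sC) fe ge nam.
apply: nam0.
pose a : #|A0|.-tuple (sub_fin s) := enum_tuple A0.
have [r ar] : exists r, a = map_tuple (tnth u) r.
  by apply: tuple_reindex => i; exact: memA.
have aS i : S (tnth (map_tuple (@sub_val _ _ s) a) i).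
  by rewrite tnth_map; apply: sinS; exact: ssvalP.
(* However [B0] and [C0] are embedded in [M], they contain the pinning sets, so the types of
   subtuples of [v] and [w] are preserved. *)
have E1 : eqtp (map_tuple (@sub_val _ _ s) a) (map_tuple (eB \o iB) (map_tuple f a)).
  rewrite ar !map_tuple_tnth -vu; apply: eqtp_reindex.
  exact: pins_embedding pB (embedding_comp iBe eBe) vf.
have E2 : eqtp (map_tuple h' (map_tuple (@sub_val _ _ s) a)) (map_tuple (eC \o iC) (map_tuple g a)).
  rewrite ar !map_tuple_tnth -vu; apply: eqtp_reindex.
  exact: pins_embedding pC (embedding_comp iCe eCe) wg.
(* [A0] has fewer than [k] elements, so [htype] links the two preserved types. An automorphism then
   matches the copies of [A0], which yields the amalgam that SEAP excluded. *)
have [sigma [siso hsigma]] := eqtp_automorphism hcount hcat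
  (eqtp_trans (eqtp_trans (eqtp_sym E1) (htype _ _ A0k aS)) E2).
apply: (@amalgam_in _ M _ _ _ _ _ (sigma \o eB) eC) => //.
  exact: embedding_comp eBe siso.1.
move=> [x xA0] /=.
have [j xj] : exists j, x = tnth a j.
  by apply/tnthP; rewrite mem_enum.
have := congr1 (fun z => tnth z j) hsigma.
by rewrite !tnth_map -xj.
Qed.

End Main.

Theorem theorem1p1 (V : vocabulary) (M : structure V)
  (hcount : countably_infinite M)
  (hmc : model_complete M)
  (hcat : omega_categorical M) :
  SEAP (Age M) <-> homogenizable M.
Proof.
split; [exact: SEAP_homogenizable|exact: homogenizable_SEAP].
Qed.
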